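(* Let $\Delta$ be a saturated sample set. There exists an effective procedure that produces, for any finite $\Delta$-diagram $\delta$ and any term variable $x$, an algorithmic description of a time warp $f$ that strongly extends $\delta_x$.
   Context: Time warps: $\overline{\omega}=\omega\cup\{\omega\}$ with its natural order; a time warp is a monotone $f\colon\overline\omega\to\overline\omega$ with $f(0)=0$, $f(\omega)=\bigvee_{n\in\omega}f(n)$; $\mathrm{last}(f):=\bigwedge\{p\in\overline\omega\mid f(p)=f(\omega)\}$. Basic terms: $t,u::=x\mid tu\mid t^{o}\mid t^{\ell}\mid t^{r}\mid\mathrm{id}\mid\bot$ ($x$ a term variable). Samples: $\alpha::=\kappa\mid t[\alpha]\mid\mathsf{s}(\alpha)\mid\mathsf{p}(\alpha)\mid\mathsf{last}(t)$ ($\kappa$ a time variable, $t$ a basic term). Relation $\leadsto$: $t[\alpha]\leadsto\alpha$; $\mathsf{s}(\alpha)\leadsto\alpha$; $\mathsf{p}(\alpha)\leadsto\alpha$; $(tu)[\alpha]\leadsto t[u[\alpha]]$; $t^{o}[\alpha]\leadsto t[\alpha]$; $t^{r}[\alpha]\leadsto t[t^{r}[\alpha]], t[\mathsf{s}(t^{r}[\alpha])]$; $t^{\ell}[\alpha]\leadsto t[t^{\ell}[\alpha]], t[\mathsf{p}(t^{\ell}[\alpha])]$; $t[\alpha]\leadsto t[\mathsf{last}(t)]$. A sample set is saturated if closed under $\leadsto$. For $p\in\overline\omega$: $p\ominus1=p-1$ if $p\in\omega\setminus\{0\}$, else $p$; $p\oplus1=p+1$ if $p\in\omega$, else $p$.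 For a saturated sample set $\Delta$, a $\Delta$-diagram is a map $\delta\colon\Delta\to\overline\omega$ such that (all samples mentioned belonging to $\Delta$): (S1) $\delta(\alpha)\le\delta(\beta)\Rightarrow\delta(t[\alpha])\le\delta(t[\beta])$; (S2) $\delta(\alpha)=0\Rightarrow\delta(t[\alpha])=0$; (S3) $\delta(\mathsf{p}(\alpha))=\delta(\alpha)\ominus1$; (S4) $\delta(\mathsf{s}(\alpha))=\delta(\alpha)\oplus1$; (S5) for $t[\alpha]\in\Delta$: $\delta(\mathsf{last}(t))\le\delta(\alpha)\iff\delta(t[\alpha])=\delta(t[\mathsf{last}(t)])$; (S6) $\delta(\mathsf{last}(t))=\omega\Rightarrow\delta(t[\mathsf{last}(t)])=\omega$; (L1) $\delta(\mathrm{id}[\alpha])=\delta(\alpha)$; (L2) if $\bot[\alpha]\in\Delta$ then $\delta(\mathsf{last}(\bot))=0$; (L3) $\delta((tu)[\alpha])=\delta(t[u[\alpha]])$; (L4) if $(tu)[\mathsf{last}(tu)]\in\Delta$ and $\delta(\mathsf{last}(tu))=\omega$ then $\delta(\mathsf{last}(t))=\delta(\mathsf{last}(u))=\omega$; (O1) $\delta(t^{o}[\alpha])\in\{0,\omega\}$; (O2) $\delta(\alpha)<\omega\Rightarrow(\delta(t^{o}[\alpha])=\omega\iff\delta(t[\alpha])=\omega)$; (O3) $\delta(\mathsf{last}(t^{o}))<\omega$; (O4) for $t[\alpha],t^{o}[\mathsf{last}(t^{o})]\in\Delta$: if $\delta(t^{o}[\mathsf{last}(t^{o})])<\omega$ and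 $\delta(\alpha)<\omega$ then $\delta(t[\alpha])<\omega$; (R1) $\delta(t[t^{r}[\alpha]])\le\delta(\alpha)$; (R2) for $t^{r}[\alpha]\in\Delta$: if $0<\delta(\alpha)<\omega$ and $\delta(t^{r}[\alpha])<\omega$ then $\delta(\alpha)<\delta(t[\mathsf{s}(t^{r}[\alpha])])$; (R3) for $t^{r}[\mathsf{last}(t^{r})]\in\Delta$: $\delta(\mathsf{last}(t^{r}))=\omega\Rightarrow\delta(\mathsf{last}(t))=\omega$; (R4) for $t^{r}[\mathsf{last}(t^{r})]\in\Delta$: $\delta(t^{r}[\mathsf{last}(t^{r})])<\omega\Rightarrow\delta(t[\mathsf{s}(t^{r}[\mathsf{last}(t^{r})])])=\omega$; (Λ1) for $t[t^{\ell}[\alpha]]\in\Delta$: $\delta(t^{\ell}[\alpha])<\omega\Rightarrow\delta(\alpha)\le\delta(t[t^{\ell}[\alpha]])$; (Λ2) for $t^{\ell}[\alpha]\in\Delta$: if $0<\delta(\alpha)<\omega$ and $\delta(t^{\ell}[\alpha])<\omega$ then $\delta(t[\mathsf{p}(t^{\ell}[\alpha])])<\delta(\alpha)$; (Λ3) for $t[t^{\ell}[\alpha]]\in\Delta$: if $\delta(\alpha)<\omega$ and $\delta(t^{\ell}[\alpha])=\omega$ then $\delta(t[t^{\ell}[\alpha]])<\delta(\alpha)$; (Λ4) for $t^{\ell}[\mathsf{last}(t^{\ell})]\in\Delta$: $\delta(\mathsf{last}(t^{\ell}))=\omega\Rightarrow\delta(\mathsf{last}(t))=\omega$; (Λ5)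 for $t^{\ell}[\mathsf{last}(t^{\ell})]\in\Delta$: $\delta(t^{\ell}[\mathsf{last}(t^{\ell})])<\omega\Rightarrow\delta(t[t^{\ell}[\mathsf{last}(t^{\ell})]])=\omega$. For a $\Delta$-diagram $\delta$ and basic term $t$, let $\delta_t:=\{(\delta(\alpha),\delta(t[\alpha]))\mid t[\alpha]\in\Delta\}$. A time warp $f$ extends $\delta_t$ if $f(i)=j$ for all $(i,j)\in\delta_t$, and strongly extends $\delta_t$ if moreover either $\delta_t=\emptyset$, or ($\delta_t\ne\emptyset$ and $\delta(\mathsf{last}(t))=\omega$ implies $\mathrm{last}(f)=\omega$). A diagram is finite if its domain $\Delta$ is finite. *)

(* Defs.v *)
From Stdlib Require Import Arith List.
Import ListNotations.

Inductive omb : Type := Fin (n : nat) | Om.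

Definition omb_le (a b : omb) : Prop :=
  match a, b with
  | Fin m, Fin n => m <= n
  | _, Om => True
  | Om, Fin _ => False
  end.

Definition omb_lt (a b : omb) : Prop := omb_le a b /\ a <> b.

Definition omb_pred (p : omb) : omb :=
  match p with Fin (S n) => Fin n | _ => p end.
Definition omb_succ (p : omb) : omb :=
  match p with Fin n => Fin (S n) | Om => Om end.

Definition is_lub (P : omb -> Prop) (v : omb) : Prop :=
  (forall a, P a -> omb_le a v) /\
  (forall u, (forall a, P a -> omb_le a u) -> omb_le v u).
Definition is_glb (P : omb -> Prop) (v : omb) : Prop :=
  (forall a, P a -> omb_le v a) /\
  (forall u, (forall a, P a -> omb_le u a) -> omb_le u v).

Definition time_warp (f : omb -> omb) : Prop :=
  (forall p q, omb_le p q -> omb_le (f p) (f q)) /\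
  f (Fin 0) = Fin 0 /\
  is_lub (fun a => exists n, a = f (Fin n)) (f Om).

Definition is_last (f : omb -> omb) (l : omb) : Prop :=
  is_glb (fun p => f p = f Om) l.

Inductive term : Type :=
| TVar (x : nat)
| TApp (t u : term)
| TO (t : term)
| TL (t : term)
| TR (t : term)
| TId
| TBot.

Inductive sample : Type :=
| SVar (k : nat)
| SAt (t : term) (a : sample)
| SS (a : sample)
| SP (a : sample)
| SLast (t : term).

Inductive leads : sample -> sample -> Prop :=
| ld_at t a : leads (SAt t a) a
| ld_s a : leads (SS a) a
| ld_p a : leads (SP a) a
| ld_app t u a : leads (SAt (TApp t u) a) (SAt t (SAt u a))
| ld_o t a : leads (SAt (TO t) a) (SAt t a)
| ld_r1 t a : leads (SAt (TR t) a) (SAt t (SAt (TR t) a))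
| ld_r2 t a : leads (SAt (TR t) a) (SAt t (SS (SAt (TR t) a)))
| ld_l1 t a : leads (SAt (TL t) a) (SAt t (SAt (TL t) a))
| ld_l2 t a : leads (SAt (TL t) a) (SAt t (SP (SAt (TL t) a)))
| ld_last t a : leads (SAt t a) (SAt t (SLast t)).

Definition saturated (D : sample -> Prop) : Prop :=
  forall a b, D a -> leads a b -> D b.


(* Delta-diagrams; delta is given as a total map, constrained only on D *)
Definition diagram (D : sample -> Prop) (d : sample -> omb) : Prop :=
  (forall t a b, D (SAt t a) -> D (SAt t b) ->
     omb_le (d a) (d b) -> omb_le (d (SAt t a)) (d (SAt t b))) /\
  (forall t a, D (SAt t a) -> d a = Fin 0 -> d (SAt t a) = Fin 0) /\
  (forall a, D (SP a) -> d (SP a) = omb_pred (d a)) /\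
  (forall a, D (SS a) -> d (SS a) = omb_succ (d a)) /\
  (forall t a, D (SAt t a) ->
     (omb_le (d (SLast t)) (d a) <-> d (SAt t a) = d (SAt t (SLast t)))) /\
  (forall t, D (SAt t (SLast t)) -> d (SLast t) = Om -> d (SAt t (SLast t)) = Om) /\
  (forall a, D (SAt TId a) -> d (SAt TId a) = d a) /\
  (forall a, D (SAt TBot a) -> d (SLast TBot) = Fin 0) /\
  (forall t u a, D (SAt (TApp t u) a) -> d (SAt (TApp t u) a) = d (SAt t (SAt u a))) /\
  (forall t u, D (SAt (TApp t u) (SLast (TApp t u))) ->
     d (SLast (TApp t u)) = Om -> d (SLast t) = Om /\ d (SLast u) = Om) /\
  (forall t a, D (SAt (TO t) a) -> d (SAt (TO t) a) = Fin 0 \/ d (SAt (TO t) a) = Om) /\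
  (forall t a, D (SAt (TO t) a) -> omb_lt (d a) Om ->
     (d (SAt (TO t) a) = Om <-> d (SAt t a) = Om)) /\
  (forall t, D (SLast (TO t)) -> omb_lt (d (SLast (TO t))) Om) /\
  (forall t a, D (SAt t a) -> D (SAt (TO t) (SLast (TO t))) ->
     omb_lt (d (SAt (TO t) (SLast (TO t)))) Om -> omb_lt (d a) Om ->
     omb_lt (d (SAt t a)) Om) /\
  (forall t a, D (SAt t (SAt (TR t) a)) -> omb_le (d (SAt t (SAt (TR t) a))) (d a)) /\
  (forall t a, D (SAt (TR t) a) -> omb_lt (Fin 0) (d a) -> omb_lt (d a) Om ->
     omb_lt (d (SAt (TR t) a)) Om ->
     omb_lt (d a) (d (SAt t (SS (SAt (TR t) a))))) /\
  (forall t, D (SAt (TR t) (SLast (TR t))) -> d (SLast (TR t)) = Om -> d (SLast t) = Om) /\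
  (forall t, D (SAt (TR t) (SLast (TR t))) ->
     omb_lt (d (SAt (TR t) (SLast (TR t)))) Om ->
     d (SAt t (SS (SAt (TR t) (SLast (TR t))))) = Om) /\
  (forall t a, D (SAt t (SAt (TL t) a)) -> omb_lt (d (SAt (TL t) a)) Om ->
     omb_le (d a) (d (SAt t (SAt (TL t) a)))) /\
  (forall t a, D (SAt (TL t) a) -> omb_lt (Fin 0) (d a) -> omb_lt (d a) Om ->
     omb_lt (d (SAt (TL t) a)) Om ->
     omb_lt (d (SAt t (SP (SAt (TL t) a)))) (d a)) /\
  (forall t a, D (SAt t (SAt (TL t) a)) -> omb_lt (d a) Om ->
     d (SAt (TL t) a) = Om -> omb_lt (d (SAt t (SAt (TL t) a))) (d a)) /\
  (forall t, D (SAt (TL t) (SLast (TL t))) -> d (SLast (TL t)) = Om -> d (SLast t) = Om) /\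
  (forall t, D (SAt (TL t) (SLast (TL t))) ->
     omb_lt (d (SAt (TL t) (SLast (TL t)))) Om ->
     d (SAt t (SAt (TL t) (SLast (TL t)))) = Om).

Definition extends (D : sample -> Prop) (d : sample -> omb) (t : term)
    (f : omb -> omb) : Prop :=
  forall a, D (SAt t a) -> f (d a) = d (SAt t a).

Definition delta_t_empty (D : sample -> Prop) (t : term) : Prop :=
  forall a, ~ D (SAt t a).

Definition strongly_extends (D : sample -> Prop) (d : sample -> omb) (t : term)
    (f : omb -> omb) : Prop :=
  extends D d t f /\
  (delta_t_empty D t \/
   (~ delta_t_empty D t ->
    d (SLast t) = Om -> forall l, is_last f l -> l = Om)).

(* Main.v *)
Require Import Defs.
From Stdlib Require Import List Arith Lia.
Import ListNotations.

(* The pairs (delta(a), delta(t[a])) form a finite partial map on overline-omega which, by (S1)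
   and (S2), is monotone and sends 0 to 0.  Take its least monotone extension on the finite
   points, send omega to c (its value at omega if it has one, else omega), and add a ramp that
   climbs to c only beyond the largest finite argument: this is a time warp extending the map.
   If delta(last(t)) = omega, then (S5) and (S6) make the map send finite arguments to finite
   values and omega to omega; so c = omega while every finite point keeps a finite image, i.e.
   last(f) = omega. *)

Lemma omb_le_refl a : omb_le a a.
Proof. destruct a; simpl; auto. Qed.

Lemma omb_le_trans a b c : omb_le a b -> omb_le b c -> omb_le a c.
Proof. destruct a, b, c; simpl; intros; try lia; tauto. Qed.

Lemma omb_le_antisym a b : omb_le a b -> omb_le b a -> a = b.
Proof. destruct a, b; simpl; intros; try tauto. f_equal; lia. Qed.

Lemma omb_le_0 a : omb_le (Fin 0) a.
Proof. destruct a; simpl; auto; lia. Qed.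

Definition omb_leb (a b : omb) : bool :=
  match a, b with
  | Fin m, Fin n => m <=? n
  | _, Om => true
  | Om, Fin _ => false
  end.

Lemma omb_leb_le a b : omb_leb a b = true <-> omb_le a b.
Proof. destruct a, b; simpl; try apply Nat.leb_le; split; auto; congruence. Qed.

Definition omb_max (a b : omb) : omb :=
  match a, b with Fin m, Fin n => Fin (Nat.max m n) | _, _ => Om end.

Definition omb_min (a b : omb) : omb :=
  match a, b with
  | Fin m, Fin n => Fin (Nat.min m n)
  | Fin m, Om => Fin m
  | Om, b => b
  end.

Lemma omb_max_le_compat a b a' b' :
  omb_le a a' -> omb_le b b' -> omb_le (omb_max a b) (omb_max a' b').
Proof. destruct a, b, a', b'; simpl; intros; try tauto; lia. Qed.

Lemma omb_min_le_compat a b a' b' :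
  omb_le a a' -> omb_le b b' -> omb_le (omb_min a b) (omb_min a' b').
Proof. destruct a, b, a', b'; simpl; intros; try tauto; lia. Qed.

Lemma omb_le_max_l a b : omb_le a (omb_max a b).
Proof. destruct a, b; simpl; auto; lia. Qed.

Lemma omb_le_max_r a b : omb_le b (omb_max a b).
Proof. destruct a, b; simpl; auto; lia. Qed.

Lemma omb_max_lub a b c : omb_le a c -> omb_le b c -> omb_le (omb_max a b) c.
Proof. destruct a, b, c; simpl; intros; try tauto; lia. Qed.

Lemma omb_le_min_l a b : omb_le (omb_min a b) a.
Proof. destruct a, b; simpl; auto; lia. Qed.

Section WarpOfGraph.

Variable P : list (omb * omb).

Definition sup_below (p : omb) : omb :=
  fold_right (fun iv acc => if omb_leb (fst iv) p then omb_max (snd iv) acc else acc)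
    (Fin 0) P.

Definition max_fin_arg : nat :=
  fold_right (fun iv acc => match fst iv with Fin k => Nat.max k acc | Om => acc end) 0 P.

Definition has_Om_arg : bool :=
  existsb (fun iv => match fst iv with Om => true | Fin _ => false end) P.

Definition limit_value : omb := if has_Om_arg then sup_below Om else Om.

(* The ramp [omb_min limit_value (Fin (n - max_fin_arg))] vanishes at every finite argument
   of [P], tends to [limit_value], and stays finite at finite points. *)
Definition warp_of_graph (p : omb) : omb :=
  match p with
  | Fin n => omb_max (sup_below (Fin n)) (omb_min limit_value (Fin (n - max_fin_arg)))
  | Om => limit_value
  end.

Lemma sup_below_mono p q : omb_le p q -> omb_le (sup_below p) (sup_below q).
Proof.
  intro Hpq; unfold sup_below; induction P as [|[i v] Q IH]; simpl; [lia|].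
  destruct (omb_leb i p) eqn:Hip.
  - assert (Hiq : omb_leb i q = true).
    { apply omb_leb_le in Hip; apply omb_leb_le; eapply omb_le_trans; eauto. }
    rewrite Hiq; apply omb_max_le_compat; auto using omb_le_refl.
  - destruct (omb_leb i q); auto.
    eapply omb_le_trans; [exact IH | apply omb_le_max_r].
Qed.

Lemma sup_below_upper p i v : In (i, v) P -> omb_le i p -> omb_le v (sup_below p).
Proof.
  unfold sup_below; induction P as [|[i' v'] Q IH]; simpl; [tauto|].
  intros [Heq | HQ] Hip.
  - injection Heq as -> ->. apply omb_leb_le in Hip; rewrite Hip; apply omb_le_max_l.
  - destruct (omb_leb i' p); auto.
    eapply omb_le_trans; [apply IH; auto | apply omb_le_max_r].
Qed.

Lemma sup_below_least p v :
  (forall i' v', In (i', v') P -> omb_le i' p -> omb_le v' v) -> omb_le (sup_below p) v.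
Proof.
  unfold sup_below; induction P as [|[i' v'] Q IH]; simpl; intro Hv; [apply omb_le_0|].
  destruct (omb_leb i' p) eqn:Hip.
  - apply omb_max_lub; [apply (Hv i'); auto; apply omb_leb_le; auto|].
    apply IH; intros; eapply Hv; eauto.
  - apply IH; intros; eapply Hv; eauto.
Qed.

Lemma max_fin_arg_ge n v : In (Fin n, v) P -> n <= max_fin_arg.
Proof.
  unfold max_fin_arg; induction P as [|[i' v'] Q IH]; simpl; [tauto|].
  intros [Heq | HQ]; [injection Heq as -> ->; simpl; lia|].
  specialize (IH HQ); destruct i'; lia.
Qed.

Lemma has_Om_arg_spec : has_Om_arg = true <-> exists v, In (Om, v) P.
Proof.
  unfold has_Om_arg; rewrite existsb_exists; split.
  - intros [[[n|] v] [Hin Hom]]; [discriminate | eauto].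
  - intros [v Hin]; exists (Om, v); auto.
Qed.

Lemma sup_below_finite p :
  (forall i v, In (i, v) P -> omb_le i p -> v <> Om) -> sup_below p <> Om.
Proof.
  unfold sup_below; induction P as [|[i v] Q IH]; simpl; intro Hfin; [discriminate|].
  specialize (IH (fun i' v' H => Hfin i' v' (or_intror H))).
  destruct (omb_leb i p) eqn:Hip; [|exact IH].
  apply omb_leb_le in Hip; specialize (Hfin i v (or_introl eq_refl) Hip).
  destruct v, fold_right; simpl; congruence.
Qed.

Lemma sup_below_le_limit_value n : omb_le (sup_below (Fin n)) limit_value.
Proof.
  unfold limit_value; destruct has_Om_arg.
  - apply sup_below_mono; exact I.
  - destruct (sup_below (Fin n)); exact I.
Qed.

Lemma warp_of_graph_mono p q : omb_le p q -> omb_le (warp_of_graph p) (warp_of_graph q).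
Proof.
  destruct p as [n|], q as [m|]; simpl; intro Hpq; try tauto.
  - apply omb_max_le_compat; [apply sup_below_mono; exact Hpq|].
    apply omb_min_le_compat; [apply omb_le_refl | simpl; lia].
  - apply omb_max_lub; [apply sup_below_le_limit_value | apply omb_le_min_l].
  - apply omb_le_refl.
Qed.

Lemma warp_of_graph_lub :
  is_lub (fun a => exists n, a = warp_of_graph (Fin n)) (warp_of_graph Om).
Proof.
  split.
  - intros a [n ->]; apply warp_of_graph_mono; exact I.
  - intros [k|] Hub; [|destruct (warp_of_graph Om); exact I].
    pose proof (Hub _ (ex_intro _ (max_fin_arg + S k) eq_refl)) as Hk; simpl in Hk.
    replace (max_fin_arg + S k - max_fin_arg) with (S k) in Hk by lia.
    pose proof (omb_le_trans _ _ _ (omb_le_max_r _ _) Hk) as Hramp.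
    simpl; destruct limit_value; simpl in *; lia.
Qed.

Hypothesis graph_zero : forall v, In (Fin 0, v) P -> v = Fin 0.

Lemma warp_of_graph_time_warp : time_warp warp_of_graph.
Proof.
  split; [exact warp_of_graph_mono | split; [|exact warp_of_graph_lub]].
  assert (Hzero : sup_below (Fin 0) = Fin 0).
  { apply omb_le_antisym; [|apply omb_le_0].
    apply sup_below_least; intros [[|k]|] v' Hin Hle; simpl in Hle; try lia; try tauto.
    rewrite (graph_zero _ Hin); exact (omb_le_refl _). }
  simpl; rewrite Hzero; destruct limit_value; simpl; auto; f_equal; lia.
Qed.

Hypothesis graph_mono :
  forall i v i' v', In (i, v) P -> In (i', v') P -> omb_le i i' -> omb_le v v'.

Lemma sup_below_graph i v : In (i, v) P -> sup_below i = v.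
Proof.
  intro Hin; apply omb_le_antisym.
  - apply sup_below_least; intros; eapply graph_mono; eauto.
  - eapply sup_below_upper; eauto using omb_le_refl.
Qed.

Lemma warp_of_graph_extends i v : In (i, v) P -> warp_of_graph i = v.
Proof.
  intro Hin; destruct i as [n|]; simpl.
  - rewrite (sup_below_graph _ _ Hin).
    replace (n - max_fin_arg) with 0 by (pose proof (max_fin_arg_ge _ _ Hin); lia).
    destruct limit_value, v; simpl; auto; f_equal; lia.
  - unfold limit_value.
    replace has_Om_arg with true by (symmetry; apply has_Om_arg_spec; eauto).
    apply sup_below_graph; exact Hin.
Qed.

Hypothesis graph_finite : forall i v, In (i, v) P -> (i = Om <-> v = Om).

Lemma limit_value_Om : limit_value = Om.
Proof.
  unfold limit_value; destruct has_Om_arg eqn:Hom; auto.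
  apply has_Om_arg_spec in Hom as [v Hin].
  rewrite (sup_below_graph _ _ Hin); apply (graph_finite _ _ Hin); reflexivity.
Qed.

Lemma warp_of_graph_last l : is_last warp_of_graph l -> l = Om.
Proof.
  intros [_ Hgreatest]; apply omb_le_antisym; [destruct l; exact I|].
  apply Hgreatest; intros [m|] Hm; [|exact I].
  simpl in Hm; rewrite limit_value_Om in Hm.
  assert (Hfin : sup_below (Fin m) <> Om).
  { apply sup_below_finite; intros i v Hin Hle Hv.
    apply (graph_finite _ _ Hin) in Hv; subst; exact Hle. }
  destruct sup_below; simpl in Hm; congruence.
Qed.

End WarpOfGraph.

Definition term_eq_dec (t u : term) : {t = u} + {t <> u}.
Proof. decide equality; apply Nat.eq_dec. Defined.

Definition graph_of (Dl : list sample) (d : sample -> omb) (t : term) : list (omb * omb) :=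
  flat_map (fun s => match s with
                     | SAt u a => if term_eq_dec u t then [(d a, d s)] else []
                     | _ => []
                     end) Dl.

Lemma in_graph_of Dl d t i v :
  In (i, v) (graph_of Dl d t) <->
  exists a, In (SAt t a) Dl /\ i = d a /\ v = d (SAt t a).
Proof.
  unfold graph_of; rewrite in_flat_map; split.
  - intros [[k|u a|a|a|u] [Hs Hin]]; try contradiction.
    destruct (term_eq_dec u t) as [->|]; [|contradiction].
    destruct Hin as [Heq|[]]; injection Heq as <- <-; eauto.
  - intros [a [Hs [-> ->]]]; exists (SAt t a); split; [exact Hs|].
    destruct (term_eq_dec t t); [left; reflexivity | contradiction].
Qed.

Section DiagramGraph.

Variables (Dl : list sample) (d : sample -> omb) (t : term).
Hypothesis Hd : diagram (fun a => In a Dl) d.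

Lemma diagram_graph_mono i v i' v' :
  In (i, v) (graph_of Dl d t) -> In (i', v') (graph_of Dl d t) ->
  omb_le i i' -> omb_le v v'.
Proof.
  destruct Hd as [S1 _].
  intros Hin Hin'; apply in_graph_of in Hin as [a [Ha [-> ->]]].
  apply in_graph_of in Hin' as [b [Hb [-> ->]]].
  exact (S1 t a b Ha Hb).
Qed.

Lemma diagram_graph_zero v : In (Fin 0, v) (graph_of Dl d t) -> v = Fin 0.
Proof.
  destruct Hd as [_ [S2 _]].
  intro Hin; apply in_graph_of in Hin as [a [Ha [Hz ->]]].
  exact (S2 t a Ha (eq_sym Hz)).
Qed.

(* Saturation puts t[last(t)] into the domain, so (S6) applies and (S5) reads
   delta(a) = omega <-> delta(t[a]) = omega. *)
Lemma diagram_graph_finite :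
  saturated (fun a => In a Dl) -> d (SLast t) = Om ->
  forall i v, In (i, v) (graph_of Dl d t) -> (i = Om <-> v = Om).
Proof.
  destruct Hd as [_ [_ [_ [_ [S5 [S6 _]]]]]].
  intros Hsat Hlast i v Hin; apply in_graph_of in Hin as [a [Ha [-> ->]]].
  assert (Hat_last : In (SAt t (SLast t)) Dl) by (eapply Hsat; [exact Ha | constructor]).
  pose proof (S5 _ _ Ha) as Hiff; rewrite Hlast, (S6 _ Hat_last Hlast) in Hiff.
  destruct (d a); simpl in Hiff; split; intro H; try discriminate; try tauto; apply Hiff; exact I.
Qed.

Lemma diagram_warp_strongly_extends :
  saturated (fun a => In a Dl) ->
  time_warp (warp_of_graph (graph_of Dl d t)) /\
  strongly_extends (fun a => In a Dl) d t (warp_of_graph (graph_of Dl d t)).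
Proof.
  intro Hsat; split; [|split].
  - exact (warp_of_graph_time_warp _ diagram_graph_zero).
  - intros a Ha; apply warp_of_graph_extends; [exact diagram_graph_mono|].
    apply in_graph_of; eauto.
  - right; intros _ Hlast.
    exact (warp_of_graph_last _ diagram_graph_mono (diagram_graph_finite Hsat Hlast)).
Qed.

End DiagramGraph.

Theorem lemma3p16 :
  forall (Dl : list sample),
    saturated (fun a => In a Dl) ->
    forall (d : sample -> omb), diagram (fun a => In a Dl) d ->
    forall x : nat,
      { f : omb -> omb | time_warp f /\
          strongly_extends (fun a => In a Dl) d (TVar x) f }.
Proof.
  intros Dl Hsat d Hd x.
  exists (warp_of_graph (graph_of Dl d (TVar x))).
  exact (diagram_warp_strongly_extends _ _ _ Hd Hsat).
Qed.
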